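(* Let $n\in\mathbb{N}$ and $S\subseteq\mathbb{R}^n$. Then $S$ is bounded MICP representable if and only if there exist $p,k\in\mathbb{N}$ and nonempty, closed, convex sets $T_1,\dots,T_k\subseteq\mathbb{R}^{n+p}$ such that $S=\bigcup_{i=1}^k \operatorname{proj}_x(T_i)$. In particular, for such $S$ (given $p,k\in\mathbb{N}$ and nonempty, closed, convex sets $T_1,\dots,T_k\subseteq\mathbb{R}^{n+p}$ with $S=\bigcup_{i=1}^k \operatorname{proj}_x(T_i)$) an MICP formulation of $S$, with integer variables $z=(z_1,\dots,z_k)$ and continuous variables $x\in\mathbb{R}^n$, $x_i\in\mathbb{R}^n$, $y_i\in\mathbb{R}^p$ ($i=1,\dots,k$), $t\in\mathbb{R}$, is given by $$x=\sum_{i=1}^k x_i,\qquad (x_i,y_i,z_i)\in\hat T_i\ \ \forall i\in\{1,\dots,k\},\qquad \sum_{i=1}^k z_i=1,\qquad z\in\{0,1\}^k,$$ $$\|x_i\|_2^2\le z_i t\ \ \forall i\in\{1,\dots,k\},\qquad t\ge 0,$$ where $\hat T_i\subseteq\mathbb{R}^{n+p+1}$ is the closed conic hull of $T_i$, i.e. the closure of $\{(x,y,z)\in\mathbb{R}^n\times\mathbb{R}^p\times\mathbb{R} : (x,y)/z\in T_i,\ z>0\}$. That is, $S$ is exactly the set of $x\in\mathbb{R}^n$ for which there exist $x_i,y_i,z,t$ satisfying this system, and the continuous relaxation of the system (replacing $z\in\{0,1\}^k$ by $z\in[0,1]^k$) defines a closed convex set.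
   Context: $\mathbb{N}=\{0,1,2,\dots\}$. For a set $M\subseteq\mathbb{R}^{n+p+d}$ with variables $(x,y,z)\in\mathbb{R}^n\times\mathbb{R}^p\times\mathbb{R}^d$, $\operatorname{proj}_x(M)=\{x\in\mathbb{R}^n : \exists (y,z)\in\mathbb{R}^{p+d},\ (x,y,z)\in M\}$, and similarly for $\operatorname{proj}_y,\operatorname{proj}_z$; for $T\subseteq\mathbb{R}^{n+p}$, $\operatorname{proj}_x(T)=\{x\in\mathbb{R}^n:\exists y\in\mathbb{R}^p,\ (x,y)\in T\}$. A closed convex set $M\subseteq\mathbb{R}^{n+p+d}$ induces an MICP (mixed-integer convex programming) formulation of $S\subseteq\mathbb{R}^n$ if $S=\operatorname{proj}_x\big(M\cap(\mathbb{R}^{n+p}\times\mathbb{Z}^d)\big)$. The set $S$ is MICP representable if there exists such an MICP formulation (for some $p,d\in\mathbb{N}$). The set $S$ is bounded MICP representable if there exists an MICP formulation of $S$ for which, in addition, $\operatorname{proj}_z\big(M\cap(\mathbb{R}^{n+p}\times\mathbb{Z}^d)\big)$ is finite. *)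

(* Defs.v *)
From HB Require Import structures.
From mathcomp Require Import all_boot all_order all_algebra.
From mathcomp Require Import all_classical all_reals all_analysis.

Set Implicit Arguments.
Unset Strict Implicit.
Unset Printing Implicit Defensive.

Import Order.TTheory GRing.Theory Num.Theory.
Import numFieldNormedType.Exports.

Local Open Scope classical_set_scope.
Local Open Scope ring_scope.

(* R^(n+p) and R^(n+p+d) are spaces of row vectors; (x, y) is [row_mx x y] and
   (x, y, z) is [row_mx (row_mx x y) z]. All dimensions may be 0. *)

Section micp.
Variable R : realType.

Definition proj2_x n p (T : set 'rV[R]_(n + p)) : set 'rV[R]_n :=
  [set x | exists y, T (row_mx x y)].

Definition proj3_x n p d (M : set 'rV[R]_(n + p + d)) : set 'rV[R]_n :=
  [set x | exists y z, M (row_mx (row_mx x y) z)].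

Definition proj3_z n p d (M : set 'rV[R]_(n + p + d)) : set 'rV[R]_d :=
  [set z | exists x y, M (row_mx (row_mx x y) z)].

(* R^m x Z^d *)
Definition mixed_lattice m d : set 'rV[R]_(m + d) :=
  [set u | forall j, rsubmx u 0 j \is a Num.int].

Definition micp_formulation n p d (M : set 'rV[R]_(n + p + d))
    (S : set 'rV[R]_n) : Prop :=
  [/\ closed M, @convex_set R 'rV[R]_(n + p + d) M
    & S = proj3_x (M `&` @mixed_lattice (n + p) d)].

Definition bounded_micp_representable n (S : set 'rV[R]_n) : Prop :=
  exists p d (M : set 'rV[R]_(n + p + d)),
    micp_formulation M S /\
    finite_set (proj3_z (M `&` @mixed_lattice (n + p) d)).

(* The norm provided by the library on row vectors is the sup norm. *)
Definition l2norm n (u : 'rV[R]_n) : R := Num.sqrt (\sum_j u 0 j ^+ 2).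

Definition closed_conic_hull m (T : set 'rV[R]_m) : set 'rV[R]_(m + 1) :=
  closure [set u : 'rV[R]_(m + 1) |
    let w := lsubmx u in let z := rsubmx u 0 0 in 0 < z /\ T (z^-1 *: w)].

(* The i-th rows of xs and ys are x_i and y_i. Z is the set in which each z_i
   is constrained to lie: {0, 1} for the formulation itself, [0, 1] for its
   continuous relaxation. *)
Definition union_system n p k (Z : set R) (T : 'I_k -> set 'rV[R]_(n + p))
    (x : 'rV[R]_n) (xs : 'M[R]_(k, n)) (ys : 'M[R]_(k, p)) (t : R)
    (z : 'rV[R]_k) : Prop :=
  [/\ x = \sum_i row i xs,
      forall i, closed_conic_hull (T i)
        (row_mx (row_mx (row i xs) (row i ys)) (z 0 i)%:M),
      \sum_i z 0 i = 1 /\ (forall i, Z (z 0 i)),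
      forall i, l2norm (row i xs) ^+ 2 <= z 0 i * t
    & 0 <= t].

(* The solution set of the relaxed system, the continuous variables other than
   x being the single vector (x_1, ..., x_k, y_1, ..., y_k, t). *)
Definition union_relaxation n p k (T : 'I_k -> set 'rV[R]_(n + p)) :
    set 'rV[R]_(n + (k * n + k * p + 1) + k) :=
  [set u | exists x xs ys t z,
     u = row_mx (row_mx x (row_mx (row_mx (mxvec xs) (mxvec ys)) t%:M)) z /\
     union_system `[0, 1] T x xs ys t z].

End micp.

(* Main.v *)
(** An integer-feasible z of a bounded formulation ranges over a finite set, and
    the fibers of M over these finitely many z are the sets T_i. Conversely,
    when z is the i-th unit vector, the constraints |x_j|^2 <= z_j t force
    x_j = 0 for j <> i, so x = x_i, and the slice of the closed conic hull of
    T_i at z_i = 1 is T_i itself. (Without these quadratic constraints the x_j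
    could be nonzero recession directions.) Each of them
    defines a rotated second-order cone, so the relaxation is closed and convex. *)
Require Import Defs.
From mathcomp Require Import all_boot all_order all_algebra.
From mathcomp Require Import all_classical all_reals all_analysis.
From mathcomp Require Import ring lra.

Set Implicit Arguments.
Unset Strict Implicit.
Unset Printing Implicit Defensive.

Import Order.TTheory GRing.Theory Num.Theory.
Import numFieldNormedType.Exports.

Local Open Scope classical_set_scope.
Local Open Scope ring_scope.

(** Two positive real weights are easier to rescale and divide than a weight bundled in the unit
    interval. At the weights 0 and 1 the combination is one of the two points. *)
Lemma convex_setE (R : realType) (V : lmodType R) (A : set V) :
  @convex_set R V A <->
  (forall (a b : R) x y, 0 < a -> 0 < b -> a + b = 1 ->
     A x -> A y -> A (a *: x + b *: y)).
Proof.
split=> [cA a b x y a0 b0 ab1 Ax Ay|cA].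
  have a1 : a <= 1 by lra.
  have := cA x y (Itv01 (ltW a0) a1).
  rewrite !inE => /(_ Ax Ay); congr A.
  by congr (_ + _ *: _); rewrite /unstable.onem /=; lra.
apply/convex_setW => x y; rewrite !inE => Ax Ay k k0 k1; rewrite inE.
by apply: cA => //; rewrite /unstable.onem; lra.
Qed.

(** * Continuity of matrix-valued maps *)

Section matrix_continuity.
Variable R : realType.

(** A neighbourhood of a matrix contains a box, one neighbourhood per entry, and finitely many
    conditions holding near [x] hold simultaneously near [x]. *)
Lemma mx_continuous (T : topologicalType) m n (f : T -> 'M[R]_(m, n)) :
  (forall i j, continuous (fun x => f x i j)) -> continuous f.
Proof.
move=> cf x A [P xP PA].
have : \forall y \near x, forall ij : 'I_m * 'I_n, P ij.1 ij.2 (f y ij.1 ij.2).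
  by apply: filter_forall => -[i j]; apply: cf; exact: xP.
by apply: filterS => y Py; apply: PA => i j; exact: (Py (i, j)).
Qed.

Lemma continuous_entry (T : topologicalType) m n (f : T -> 'M[R]_(m, n)) i j :
  continuous f -> continuous (fun x => f x i j).
Proof.
by move=> cf x; exact: (continuous_comp (cf x) (@coord_continuous _ _ _ i j _)).
Qed.

Lemma continuous_lsubmx_comp (T : topologicalType) m n1 n2
    (f : T -> 'M[R]_(m, n1 + n2)) :
  continuous f -> continuous (fun x => lsubmx (f x)).
Proof.
by move=> cf x; exact: (continuous_comp (cf x) (@continuous_lsubmx _ _ _ _ _)).
Qed.

Lemma continuous_rsubmx_comp (T : topologicalType) m n1 n2
    (f : T -> 'M[R]_(m, n1 + n2)) :
  continuous f -> continuous (fun x => rsubmx (f x)).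
Proof.
by move=> cf x; exact: (continuous_comp (cf x) (@continuous_rsubmx _ _ _ _ _)).
Qed.

Lemma continuous_vec_mx (T : topologicalType) m n (f : T -> 'rV[R]_(m * n)) :
  continuous f -> continuous (fun x => vec_mx (f x)).
Proof.
move=> cf; apply: mx_continuous => i j; under eq_fun do rewrite mxE.
exact: continuous_entry.
Qed.

Lemma continuous_row (T : topologicalType) m n (f : T -> 'M[R]_(m, n)) i :
  continuous f -> continuous (fun x => row i (f x)).
Proof.
move=> cf; apply: mx_continuous => k j; under eq_fun do rewrite mxE.
exact: continuous_entry.
Qed.

Lemma continuous_row_mx (T : topologicalType) m n1 n2
    (f : T -> 'M[R]_(m, n1)) (g : T -> 'M[R]_(m, n2)) :
  continuous f -> continuous g -> continuous (fun x => row_mx (f x) (g x)).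
Proof.
move=> cf cg; apply: mx_continuous => i j.
case: (split_ordP j) => j' ->.
  under eq_fun do rewrite row_mxEl.
  exact: continuous_entry.
under eq_fun do rewrite row_mxEr.
exact: continuous_entry.
Qed.

Lemma continuous_scalar_mx (T : topologicalType) n (f : T -> R) :
  continuous f -> continuous (fun x => (f x)%:M : 'M[R]_n).
Proof.
move=> cf; apply: mx_continuous => i j; under eq_fun do rewrite mxE.
case: (i == j) => x; last exact: cvg_cst.
exact: cf.
Qed.

End matrix_continuity.

(** By continuity of [a *: u + b *: v] in the pair, points of [C] close to [p] and [q] combine to a
    point of [C] close to the combination of [p] and [q]. *)
Lemma convex_closure (R : realType) n (C : set 'rV[R]_n) :
  @convex_set R 'rV[R]_n C -> @convex_set R 'rV[R]_n (closure C).
Proof.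
move=> /convex_setE cC; apply/convex_setE => a b p q a0 b0 ab clp clq B.
have : (fun u : 'rV[R]_n * 'rV[R]_n => a *: u.1 + b *: u.2) @ (p, q)
    --> a *: p + b *: q.
  by apply: cvgD; apply: cvgZl_tmp; [exact: cvg_fst|exact: cvg_snd].
move=> /[apply] -[[U V] /= [pU qV] UVB].
have [u [Cu Uu]] := clp _ pU.
have [v [Cv Vv]] := clq _ qV.
exists (a *: u + b *: v); split; first exact: cC.
exact: (UVB (u, v)).
Qed.

(** * The closed conic hull: convexity and its slices at heights 0 and 1 *)

Section closed_conic_hull.
Variables (R : realType) (m : nat) (T : set 'rV[R]_m).

Lemma convex_closed_conic_hull :
  @convex_set R 'rV[R]_m T ->
  @convex_set R 'rV[R]_(m + 1) (closed_conic_hull T).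
Proof.
move=> /convex_setE cT; apply: convex_closure; apply/convex_setE.
move=> a b u v a0 b0 ab /= [zu Tu] [zv Tv].
set s := rsubmx u 0 0 in zu Tu; set t := rsubmx v 0 0 in zv Tv.
have -> : rsubmx (a *: u + b *: v) 0 0 = a * s + b * t by rewrite /s /t !mxE.
have st0 : 0 < a * s + b * t by rewrite addr_gt0 ?mulr_gt0.
split=> //.
(* Dividing by the combined height turns the weights [a], [b] into new positive weights, again of
   sum 1, on the rescaled points of [T]. *)
have -> : (a * s + b * t)^-1 *: lsubmx (a *: u + b *: v) =
  (a * s / (a * s + b * t)) *: (s^-1 *: lsubmx u) +
  (b * t / (a * s + b * t)) *: (t^-1 *: lsubmx v).
  apply/rowP => j; rewrite !mxE; field.
  by rewrite !gt_eqF.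
apply: cT => //; rewrite ?divr_gt0 ?mulr_gt0 //.
by rewrite -mulrDl divff // gt_eqF.
Qed.

(** For [w] in [T], the points [e *: (w, 1)] with [e > 0] lie in the cone over [T] and tend to 0
    with [e]. *)
Lemma closed_conic_hull0 : T !=set0 -> closed_conic_hull T 0.
Proof.
move=> [w Tw] B B0.
have : e *: row_mx w (1%:M : 'M[R]_1) @[e --> (0 : R)^'+] -->
    (0 : 'rV[R]_(m + 1)).
  rewrite -[X in _ --> X](scale0r (row_mx w 1%:M)).
  apply: cvgZr_tmp; exact: cvg_within.
move=> /(_ _ B0) /= nB.
near (0 : R)^'+ => e; exists (e *: row_mx w 1%:M); split; last by near: e.
have e0 : 0 < e by near: e; exact: nbhs_right_gt.
rewrite /= scale_row_mx row_mxKl row_mxKr !mxE eqxx mulr1; split=> //.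
by rewrite scalerA mulVf ?scale1r // gt_eqF.
Unshelve. all: by end_near.
Qed.

(** Division by the last coordinate is continuous at height 1 and sends the cone before closure into
    [T]. So a limit of that cone at height 1 is sent to a limit of [T], which is closed. *)
Lemma closed_conic_hull1 w :
  closed T -> closed_conic_hull T (row_mx w 1%:M) <-> T w.
Proof.
move=> Tcl; split=> [hw|Tw]; last first.
  apply: subset_closure; rewrite /= row_mxKl row_mxKr mxE eqxx.
  by rewrite invr1 scale1r.
apply: Tcl => B wB.
have : (fun u : 'rV[R]_(m + 1) => (rsubmx u 0 0)^-1 *: lsubmx u)
    @ nbhs (row_mx w 1%:M : 'rV[R]_(m + 1)) --> w.
  rewrite -[X in _ --> X]scale1r -[X in X *: _]invr1; apply: cvgZ.
    apply: cvgV => //.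
    have /(_ (row_mx w 1%:M)) :=
      @continuous_entry _ _ _ _ _ 0 0 (@continuous_rsubmx R 1 m 1).
    by rewrite /continuous_at row_mxKr mxE eqxx.
  rewrite -[X in _ --> X](row_mxKl w (1%:M : 'M[R]_1)).
  exact: continuous_lsubmx.
move=> /(_ _ wB) /hw [u [[_ Tu] Bu]].
by exists ((rsubmx u 0 0)^-1 *: lsubmx u).
Qed.

End closed_conic_hull.

(** * The rotated second-order cone *)

Section rotated_cone.
Variables (R : realType) (n : nat).
Implicit Types (x : 'rV[R]_n) (z t : R).

Lemma sqr_l2norm x : l2norm x ^+ 2 = \sum_j x 0 j ^+ 2.
Proof. by rewrite sqr_sqrtr // sumr_ge0 // => j _; rewrite sqr_ge0. Qed.

Lemma l2norm_sqr_le0 x : l2norm x ^+ 2 <= 0 -> x = 0.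
Proof.
rewrite sqr_l2norm => x0; apply/rowP => j; rewrite mxE.
have /eqP : \sum_j x 0 j ^+ 2 = 0.
  by apply/le_anti; rewrite x0 sumr_ge0 // => i _; rewrite sqr_ge0.
rewrite psumr_eq0; last by move=> i _; rewrite sqr_ge0.
by move=> /allP /(_ j (mem_index_enum _)) /=; rewrite sqrf_eq0 => /eqP.
Qed.

(** For positive [z1], [z2], this is the expansion of |z2 x1 - z1 x2|^2 >= 0 with the two bounds
    inserted, divided by [z1 * z2]. It is the cross term needed for convexity of the cone. *)
Lemma rotated_cone_polar x1 x2 z1 z2 t1 t2 :
  0 <= z1 -> 0 <= z2 -> 0 <= t1 -> 0 <= t2 ->
  l2norm x1 ^+ 2 <= z1 * t1 -> l2norm x2 ^+ 2 <= z2 * t2 ->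
  2 * (\sum_j x1 0 j * x2 0 j) <= z1 * t2 + z2 * t1.
Proof.
move=> z10 z20 t10 t20 h1 h2.
have dot0 : (x1 = 0 \/ x2 = 0) -> \sum_j x1 0 j * x2 0 j = 0.
  by move=> x0; apply: big1 => j _; case: x0 => ->; rewrite !mxE ?mul0r ?mulr0.
(* A vanishing [z1] or [z2] forces the corresponding vector to be 0, so the left side is 0. *)
have [z1E|z1n0] := eqVneq z1 0.
  rewrite dot0 ?mulr0 ?addr_ge0 ?mulr_ge0 //; left; apply: l2norm_sqr_le0.
  by rewrite (le_trans h1) // z1E mul0r.
have [z2E|z2n0] := eqVneq z2 0.
  rewrite dot0 ?mulr0 ?addr_ge0 ?mulr_ge0 //; right; apply: l2norm_sqr_le0.
  by rewrite (le_trans h2) // z2E mul0r.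
have z12 : 0 < z1 * z2 by rewrite mulr_gt0 // lt_neqAle eq_sym ?z1n0 ?z2n0.
rewrite -(ler_pM2l z12).
have : 0 <= \sum_j (z2 * x1 0 j - z1 * x2 0 j) ^+ 2.
  by rewrite sumr_ge0 // => j _; rewrite sqr_ge0.
have -> : \sum_j (z2 * x1 0 j - z1 * x2 0 j) ^+ 2 =
    z2 ^+ 2 * l2norm x1 ^+ 2 + z1 ^+ 2 * l2norm x2 ^+ 2 -
    z1 * z2 * (2 * (\sum_j x1 0 j * x2 0 j)).
  rewrite !sqr_l2norm !mulr_sumr -sumrN -!big_split /=.
  by apply: eq_bigr => j _; ring.
have := ler_wpM2l (sqr_ge0 z2) h1; have := ler_wpM2l (sqr_ge0 z1) h2.
lra.
Qed.

(** After expansion, the square terms are the two hypotheses scaled by a^2 and b^2, and the mixed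
    term is [rotated_cone_polar] scaled by [a * b]. *)
Lemma rotated_cone_convex (a b : R) x1 x2 z1 z2 t1 t2 :
  0 <= a -> 0 <= b -> 0 <= z1 -> 0 <= z2 -> 0 <= t1 -> 0 <= t2 ->
  l2norm x1 ^+ 2 <= z1 * t1 -> l2norm x2 ^+ 2 <= z2 * t2 ->
  l2norm (a *: x1 + b *: x2) ^+ 2 <= (a * z1 + b * z2) * (a * t1 + b * t2).
Proof.
move=> a0 b0 z10 z20 t10 t20 h1 h2.
have h12 := rotated_cone_polar z10 z20 t10 t20 h1 h2.
have -> : l2norm (a *: x1 + b *: x2) ^+ 2 = a ^+ 2 * l2norm x1 ^+ 2 +
    b ^+ 2 * l2norm x2 ^+ 2 + a * b * (2 * (\sum_j x1 0 j * x2 0 j)).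
  rewrite !sqr_l2norm !mulr_sumr -!big_split /=.
  by apply: eq_bigr => j _; rewrite !mxE; ring.
have := ler_wpM2l (mulr_ge0 a0 b0) h12.
have := ler_wpM2l (sqr_ge0 a) h1; have := ler_wpM2l (sqr_ge0 b) h2.
lra.
Qed.

Lemma continuous_sqr_l2norm (T : topologicalType) (f : T -> 'rV[R]_n) :
  continuous f -> continuous (fun u => l2norm (f u) ^+ 2).
Proof.
move=> cf; under eq_fun do rewrite sqr_l2norm.
apply: continuous_big => [|j _]; first exact: add_continuous.
by move=> u; apply: cvgM; exact: continuous_entry.
Qed.

End rotated_cone.

(** * The binary system and its continuous relaxation *)

Section union_system.
Variables (R : realType) (n p k : nat) (T : 'I_k -> set 'rV[R]_(n + p)).

Lemma union_system_binary x :
  (forall i, T i !=set0 /\ closed (T i)) ->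
  (exists xs ys t z, union_system [set 0; 1] T x xs ys t z) <->
  (\bigcup_(i in [set: 'I_k]) proj2_x (T i)) x.
Proof.
move=> hT; split=> [[xs [ys [t [z [xE hz [sz z01] hl _]]]]]|[i _ [y Ty]]].
  have [i zi1] : exists i, z 0 i = 1.
    apply/not_existsP => zn1; have : \sum_i z 0 i = 0.
      by apply: big1 => i _; have [|/zn1] := z01 i.
    by rewrite sz => /eqP; rewrite oner_eq0.
  (* The other entries are nonnegative and sum to 0. *)
  have z0 j : j != i -> z 0 j = 0.
    move=> ji; move: sz; rewrite (bigD1 i) //= zi1 => /eqP.
    rewrite -[X in _ == X]addr0 (inj_eq (addrI 1)) psumr_eq0.
      by move=> /allP /(_ j (mem_index_enum _)); rewrite ji => /eqP.
    by move=> l _; have [->|->] := z01 l.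
  exists i => //; exists (row i ys).
  apply/(closed_conic_hull1 _ (hT i).2).
  have -> : x = row i xs.
    rewrite xE (bigD1 i) //= big1 ?addr0 // => j ji.
    by apply: l2norm_sqr_le0; rewrite (le_trans (hl j)) // z0 // mul0r.
  by have := hz i; rewrite zi1.
(* The i-th unit vector: slot i carries [x] and [y], every other slot is the origin, and [t] is
   chosen to make the quadratic constraint of slot i an equality. *)
pose z : 'rV[R]_k := \row_j (j == i)%:R.
exists (\matrix_j (z 0 j *: x)), (\matrix_j (z 0 j *: y)), (l2norm x ^+ 2), z.
have zE j : z 0 j = (j == i)%:R by rewrite mxE.
split; last exact: sqr_ge0.
- rewrite (bigD1 i) //= big1 ?addr0 => [|j /negPf ji].
    by rewrite rowK zE eqxx scale1r.
  by rewrite rowK zE ji scale0r.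
- move=> j; rewrite !rowK zE; have [->|_] := eqVneq j i.
    by rewrite !scale1r; apply/closed_conic_hull1 => //; exact: (hT i).2.
  rewrite !scale0r raddf0 !row_mx0.
  exact: closed_conic_hull0 (hT j).1.
- split; last by move=> j; rewrite zE /=; case: (j == i); [right|left].
  rewrite (bigD1 i) //= big1 ?addr0 => [|j /negPf ji]; first by rewrite zE eqxx.
  by rewrite zE ji.
- move=> j; rewrite rowK zE; case: (j == i); first by rewrite scale1r mul1r.
  by rewrite scale0r mul0r sqr_l2norm big1 // => l _; rewrite mxE expr0n.
Qed.

(** Packing the variables by [row_mx] and [mxvec] is injective, so the existential witnesses in
    [union_relaxation] are determined by the packed vector. *)
Lemma union_relaxation_row_mx x xs ys (t : R) z :
  union_relaxation T
    (row_mx (row_mx x (row_mx (row_mx (mxvec xs) (mxvec ys)) t%:M)) z) <->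
  union_system `[0, 1] T x xs ys t z.
Proof.
split=> [[x' [xs' [ys' [t' [z' [/eq_row_mx[/eq_row_mx[->]]]]]]]]|sys];
  last first.
  by exists x, xs, ys, t, z.
move=> /eq_row_mx[/eq_row_mx[/(can_inj mxvecK)-> /(can_inj mxvecK)->]].
by move=> /matrixP /(_ 0 0); rewrite !mxE eqxx !mulr1n => -> ->.
Qed.

Lemma row_mx_union_relaxation (u : 'rV[R]_(n + (k * n + k * p + 1) + k)) :
  u = row_mx (row_mx (lsubmx (lsubmx u))
       (row_mx (row_mx
          (mxvec (vec_mx (lsubmx (lsubmx (rsubmx (lsubmx u))))))
          (mxvec (vec_mx (rsubmx (lsubmx (rsubmx (lsubmx u)))))))
          ((rsubmx (rsubmx (lsubmx u)) 0 0)%:M))) (rsubmx u).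
Proof. by rewrite !vec_mxK -mx11_scalar !hsubmxK. Qed.

Lemma convex_union_relaxation :
  (forall i, @convex_set R 'rV[R]_(n + p) (T i)) ->
  @convex_set R 'rV[R]_(n + (k * n + k * p + 1) + k) (union_relaxation T).
Proof.
move=> cT; apply/convex_setE => a b u1 u2 a0 b0 ab.
move=> [x1 [xs1 [ys1 [t1 [z1 [-> [xE1 hz1 [sz1 z01] hl1 t10]]]]]]].
move=> [x2 [xs2 [ys2 [t2 [z2 [-> [xE2 hz2 [sz2 z02] hl2 t20]]]]]]].
exists (a *: x1 + b *: x2), (a *: xs1 + b *: xs2), (a *: ys1 + b *: ys2).
exists (a * t1 + b * t2), (a *: z1 + b *: z2).
split.
  rewrite !scale_row_mx !add_row_mx !linearD !linearZ /=.
  by rewrite raddfD /= !scale_scalar_mx.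
have rE q (A B : 'M[R]_(k, q)) i :
    row i (a *: A + b *: B) = a *: row i A + b *: row i B.
  by rewrite linearD !linearZ.
have zE i : (a *: z1 + b *: z2) 0 i = a * z1 0 i + b * z2 0 i by rewrite !mxE.
(* The box constraint supplies the signs required by [rotated_cone_convex]. *)
have z1ge i : 0 <= z1 0 i by have := z01 i; rewrite /= in_itv /= => /andP[].
have z2ge i : 0 <= z2 0 i by have := z02 i; rewrite /= in_itv /= => /andP[].
split.
- rewrite xE1 xE2 !scaler_sumr -big_split /=.
  by apply: eq_bigr => i _; rewrite rE.
- move=> i; rewrite !rE zE.
  have /convex_setE/(_ a b _ _ a0 b0 ab (hz1 i) (hz2 i)) :=
    convex_closed_conic_hull (cT i).
  by rewrite !scale_row_mx !add_row_mx !scale_scalar_mx -raddfD.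
- split=> [|i].
    under eq_bigr do rewrite zE.
    by rewrite big_split /= -!mulr_sumr sz1 sz2 !mulr1.
  have := z01 i; have := z02 i; rewrite /= zE !in_itv /=.
  move=> /andP[_ z2le] /andP[_ z1le].
  (* The upper bound 1 is rewritten as [a + b], to be compared term by term. *)
  rewrite addr_ge0 ?mulr_ge0 ?(ltW a0) ?(ltW b0) //= -ab.
  by rewrite lerD // ler_piMr ?(ltW a0) ?(ltW b0).
- by move=> i; rewrite rE zE rotated_cone_convex ?(ltW a0) ?(ltW b0).
- by rewrite addr_ge0 // mulr_ge0 // ltW.
Qed.

(** Every variable of the system is a continuous function of the packed vector [u], so the
    relaxation is an intersection of preimages of closed sets under continuous maps. *)
Lemma closed_union_relaxation : closed (union_relaxation T).
Proof.
pose W := 'rV[R]_(n + (k * n + k * p + 1) + k).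
pose X (u : W) := lsubmx (lsubmx u).
pose XS (u : W) := vec_mx (lsubmx (lsubmx (rsubmx (lsubmx u)))) : 'M[R]_(k, n).
pose YS (u : W) := vec_mx (rsubmx (lsubmx (rsubmx (lsubmx u)))) : 'M[R]_(k, p).
pose t (u : W) := rsubmx (rsubmx (lsubmx u)) 0 0.
pose z (u : W) := rsubmx u.
have idc : continuous (id : W -> W) by move=> u; exact: cvg_id.
have lc := continuous_lsubmx_comp idc.
have rlc := continuous_rsubmx_comp lc.
have Xc : continuous X := continuous_lsubmx_comp lc.
have XSc : continuous XS :=
  continuous_vec_mx (continuous_lsubmx_comp (continuous_lsubmx_comp rlc)).
have YSc : continuous YS :=
  continuous_vec_mx (continuous_rsubmx_comp (continuous_lsubmx_comp rlc)).
have tc : continuous t := continuous_entry (continuous_rsubmx_comp rlc).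
have zc : continuous z := continuous_rsubmx_comp idc.
have zic i : continuous (fun u => z u 0 i) := continuous_entry zc.
have l2c i : continuous (fun u => l2norm (row i (XS u)) ^+ 2).
  exact/continuous_sqr_l2norm/continuous_row.
have sumc m (f : 'I_m -> W -> R) :
    (forall i, continuous (f i)) -> continuous (fun u => \sum_i f i u).
  by move=> cf; apply: continuous_big => //; exact: add_continuous.
have pre (V : topologicalType) (f : W -> V) (D : set V) :
    continuous f -> closed D -> closed (f @^-1` D).
  by move=> /continuous_closedP; apply.
have sysE u : union_relaxation T u <->
    union_system `[0, 1] T (X u) (XS u) (YS u) (t u) (z u).
  by rewrite {1}(row_mx_union_relaxation u); exact: union_relaxation_row_mx.
(* The equation for [x] is split into real equations by coordinate, and the quadratic bounds are
   moved to one side, so that each target set is fixed and closed. *)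
have -> : union_relaxation T =
  (\bigcap_(j in [set: 'I_n])
     (fun u => X u 0 j - \sum_i XS u i j) @^-1` [set r | r = 0]) `&`
  (\bigcap_(i in [set: 'I_k])
     (fun u => row_mx (row_mx (row i (XS u)) (row i (YS u))) (z u 0 i)%:M) @^-1`
       closed_conic_hull (T i)) `&`
  (fun u => \sum_i z u 0 i) @^-1` [set r | r = 1] `&`
  (\bigcap_(i in [set: 'I_k]) (fun u => z u 0 i) @^-1` `[0, 1]) `&`
  (\bigcap_(i in [set: 'I_k])
     (fun u => l2norm (row i (XS u)) ^+ 2 - z u 0 i * t u) @^-1`
       [set r | r <= 0])
  `&` t @^-1` [set r | 0 <= r].
  apply/seteqP; split=> u.
    move=> /sysE[xE hz [sz z01] hl t0]; do 5?split => //.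
    - move=> j _ /=; apply/eqP; rewrite subr_eq0; apply/eqP.
      by rewrite xE summxE; apply: eq_bigr => i _; rewrite mxE.
    - by move=> i _; exact: hz.
    - by move=> i _; exact: z01.
    - by move=> i _ /=; rewrite subr_le0.
  move=> [[[[[xE hz] sz] z01] hl] t0]; apply/sysE; split=> //.
  - apply/rowP => j; have /eqP := xE j I; rewrite subr_eq0 => /eqP ->.
    by rewrite summxE; apply: eq_bigr => i _; rewrite [RHS]mxE.
  - by move=> i; exact: hz.
  - by split=> // i; exact: z01.
  - by move=> i; have := hl i I; rewrite /= subr_le0.
repeat apply: closedI; try (apply: closed_bigI => i _); apply: pre => //.
- move=> u; apply: continuousB; first exact: continuous_entry.
  by apply: sumc => l; exact: continuous_entry.
- apply: continuous_row_mx; last exact: continuous_scalar_mx.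
  by apply: continuous_row_mx; exact: continuous_row.
- exact: closed_closure.
- exact: sumc.
- exact: itv_closed.
- move=> u; apply: (continuousB (l2c i u)).
  exact: (continuousM (zic i u) (tc u)).
Qed.

End union_system.

(** * From unions to bounded formulations *)

Lemma int_itv01 (R : realType) (r : R) :
  r \is a Num.int -> 0 <= r <= 1 -> r = 0 \/ r = 1.
Proof.
move=> /intrP [m ->]; rewrite ler0z lerz1.
by case: m => [[|[|m]]|m] // _; [left|right].
Qed.

(** The integers of [0, 1] are 0 and 1, so the mixed-integer points of the relaxation are the
    solutions of the binary system, handled by [union_system_binary]. *)
Lemma micp_formulation_union_relaxation (R : realType) n p k
    (T : 'I_k -> set 'rV[R]_(n + p)) :
  (forall i, [/\ T i !=set0, closed (T i)
               & @convex_set R 'rV[R]_(n + p) (T i)]) ->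
  micp_formulation (union_relaxation T)
    (\bigcup_(i in [set: 'I_k]) proj2_x (T i)).
Proof.
move=> hT; split.
- exact: closed_union_relaxation.
- by apply: convex_union_relaxation => i; case: (hT i).
apply/seteqP; split=> x.
  have hT' i : T i !=set0 /\ closed (T i) by case: (hT i).
  move=> /(union_system_binary _ hT') [xs [ys [t [z [xE hz [sz z01] hl t0]]]]].
  exists (row_mx (row_mx (mxvec xs) (mxvec ys)) t%:M), z; split.
    apply/union_relaxation_row_mx; split=> //; split=> // i.
    by rewrite /= in_itv /=; have [->|->] := z01 i; rewrite ?lexx ?ler01.
  by move=> j; rewrite row_mxKr; have [->|->] := z01 j; rewrite ?rpred0 ?rpred1.
have hT' i : T i !=set0 /\ closed (T i) by case: (hT i).
move=> [w [z [[x' [xs [ys [t [z' [/eq_row_mx[/eq_row_mx[-> _] ->]]]]]]]]]].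
move=> [xE hz [sz z01] hl t0] zint.
apply/(union_system_binary _ hT'); exists xs, ys, t, z'; split=> //.
split=> // i; apply: int_itv01; first by have := zint i; rewrite row_mxKr.
by have := z01 i; rewrite /= in_itv.
Qed.

Lemma finite_union_relaxation_z (R : realType) n p k
    (T : 'I_k -> set 'rV[R]_(n + p)) :
  finite_set (proj3_z (union_relaxation T `&`
    @mixed_lattice R (n + (k * n + k * p + 1)) k)).
Proof.
(* Feasible integer vectors have entries 0 or 1, hence come from the finite type of boolean
   functions on the indices. *)
apply: (@sub_finite_set _ _
  (range (fun b : {ffun 'I_k -> bool} => \row_i (b i)%:R : 'rV[R]_k)));
  last first.
  exact: finite_image.
move=> z [x [w [[x' [xs [ys [t [z' [/eq_row_mx[_ ->]]]]]]]]]].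
move=> [_ _ [_ z01] _ _] zint.
exists [ffun i => z' 0 i == 1] => //; apply/rowP => i; rewrite mxE ffunE.
have [||->|->] := @int_itv01 _ (z' 0 i); last by rewrite eqxx.
- by have := zint i; rewrite row_mxKr.
- by have := z01 i; rewrite /= in_itv.
by rewrite eq_sym oner_eq0.
Qed.

(** * From bounded formulations to unions of fibers *)

Lemma micp_fiber_union (R : realType) n p d (M : set 'rV[R]_(n + p + d))
    (S : set 'rV[R]_n) :
  micp_formulation M S ->
  finite_set (proj3_z (M `&` @mixed_lattice R (n + p) d)) ->
  exists k (T : 'I_k -> set 'rV[R]_(n + p)),
    (forall i, [/\ T i !=set0, closed (T i)
                 & @convex_set R 'rV[R]_(n + p) (T i)]) /\
    S = \bigcup_(i in [set: 'I_k]) proj2_x (T i).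
Proof.
move=> [Mcl /convex_setE Mcv ->] /finite_seqP [s sE].
pose zs (i : 'I_(size s)) := s`_i.
have zsP i : proj3_z (M `&` @mixed_lattice R (n + p) d) (zs i).
  by rewrite sE; exact: mem_nth.
(* One fiber of [M] per listed integer vector, nonempty by [zsP]. If none is feasible, the list is
   empty and so is the union. *)
exists (size s), (fun i => [set w | M (row_mx w (zs i))]); split=> [i|].
  split.
  - by have [x [y [Mxy _]]] := zsP i; exists (row_mx x y).
  - have /continuous_closedP :
        continuous (fun w : 'rV[R]_(n + p) => row_mx w (zs i)).
      apply: continuous_row_mx => [u|]; [exact: cvg_id|exact: cst_continuous].
    exact.
  apply/convex_setE => a b u v a0 b0 ab /= Mu Mv.
  have := Mcv a b _ _ a0 b0 ab Mu Mv.
  (* Both points share the last block, which the combination keeps because [a + b = 1]. *)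
  by rewrite !scale_row_mx add_row_mx -scalerDl ab scale1r.
apply/seteqP; split=> x.
  move=> [y [z [Mxyz zint]]].
  have : z \in s.
    have : proj3_z (M `&` @mixed_lattice R (n + p) d) z by exists x, y.
    by rewrite sE.
  move=> /(nthP 0) [j js zE]; exists (Ordinal js) => //.
  by exists y; rewrite /= /zs /= zE.
move=> [i _ [y /= My]]; exists y, (zs i); split=> //.
(* Integrality concerns only the last block, so it transfers from the point witnessing [zsP i]. *)
by have [x' [y' [_ zint]]] := zsP i => j; have := zint j; rewrite !row_mxKr.
Qed.

Theorem proposition1 (R : realType) (n : nat) (S : set 'rV[R]_n) :
  (bounded_micp_representable S <->
   exists (p k : nat) (T : 'I_k -> set 'rV[R]_(n + p)),
     (forall i, [/\ T i !=set0, closed (T i)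
                  & @convex_set R 'rV[R]_(n + p) (T i)]) /\
     S = \bigcup_(i in [set: 'I_k]) proj2_x (T i)) /\
  (forall (p k : nat) (T : 'I_k -> set 'rV[R]_(n + p)),
     (forall i, [/\ T i !=set0, closed (T i)
                  & @convex_set R 'rV[R]_(n + p) (T i)]) ->
     S = \bigcup_(i in [set: 'I_k]) proj2_x (T i) ->
     [/\ micp_formulation (union_relaxation T) S,
         S = [set x | exists xs ys t z,
                union_system [set 0; 1] T x xs ys t z],
         closed (union_relaxation T)
       & @convex_set R 'rV[R]_(n + (k * n + k * p + 1) + k)
           (union_relaxation T)]).
Proof.
split; first split.
- move=> [p [d [M [hM fM]]]].
  by have [k [T hT]] := micp_fiber_union hM fM; exists p, k, T.
- move=> [p [k [T [hT ->]]]].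
  (* The continuous variables besides [x]: the k vectors x_i, the k vectors y_i, and [t]. *)
  exists (k * n + k * p + 1)%N, k, (union_relaxation T); split.
    exact: micp_formulation_union_relaxation.
  exact: finite_union_relaxation_z.
move=> p k T hT ->; split.
- exact: micp_formulation_union_relaxation.
- have hT' i : T i !=set0 /\ closed (T i) by case: (hT i).
  by apply/seteqP; split=> x /(union_system_binary x hT').
- exact: closed_union_relaxation.
- by apply: convex_union_relaxation => i; case: (hT i).
Qed.
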